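(* If $B\subseteq 2^\omega$ is Borel, then $B\in\mathcal{E}$ if and only if Eve has a winning strategy in the game $G_{\mathcal{E}}(B)$.
   Context: $\mu$ is the standard Haar (product) measure on $2^\omega$; for a clopen $U$ of positive measure, $\mu_U(C)=\mu(C\cap U)/\mu(U)$. For $\xi\in 2^{<\omega}$, $[\xi]=\{x\in 2^\omega:\xi\subseteq x\}$. $\mathcal{E}$ is the $\sigma$-ideal of all subsets of $2^\omega$ that can be covered by countably many closed $\mu$-null sets. For $A\subseteq 2^\omega$ the game $G_{\mathcal{E}}(A)$ is the following infinite game between Adam and Eve, with turns $n=1,2,3,\ldots$, Adam moving first in each turn. In his $n$-th turn Adam picks $\xi_n\in 2^n$ extending $\xi_{n-1}$ (where $\xi_0=\emptyset$). In her $n$-th turn Eve picks a clopen set $C_n\subseteq[\xi_n]$ with $\mu_{[\xi_n]}(C_n)<\frac1n$. Let $x=\bigcup_n\xi_n\in 2^\omega$. Eve wins iff $x\notin A$ or $x\in C_n$ for all but finitely many $n$; otherwise Adam wins. *)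

(* Defs.v *)
From HB Require Import structures.
From mathcomp Require Import all_boot all_order all_algebra finmap.
From mathcomp Require Import all_classical all_reals all_analysis.

Set Implicit Arguments.
Unset Strict Implicit.
Unset Printing Implicit Defensive.

Import Order.TTheory GRing.Theory Num.Theory.

Local Open Scope classical_set_scope.
Local Open Scope ring_scope.

Definition cylinder (s : seq bool) : set cantor_space :=
  [set x | mkseq x (size s) = s].

Lemma cylinder_nth s : cylinder s (nth false s).
Proof. exact: mkseq_nth. Qed.

Lemma cylinder_nil : cylinder [::] = setT.
Proof. by apply/seteqP. Qed.

Lemma cylinder_mkseq (x : cantor_space) n : cylinder (mkseq x n) x.
Proof. by rewrite /cylinder/= size_mkseq. Qed.

Lemma cylinder_rcons s b :
  cylinder (rcons s b) = cylinder s `&` [set x | x (size s) = b].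
Proof.
apply/seteqP; split=> x; rewrite /cylinder/= size_rcons mkseqS.
  by move=> /rcons_inj[-> ->].
by move=> [-> ->].
Qed.

Lemma cylinder_split s :
  cylinder s = cylinder (rcons s true) `|` cylinder (rcons s false).
Proof.
rewrite !cylinder_rcons -setIUr -[LHS]setIT; congr (_ `&` _).
by apply/seteqP; split=> // x _ /=; case: (x (size s)); [left|right].
Qed.

Lemma le_cylinder_mkseq (x : cantor_space) m n : (m <= n)%N ->
  cylinder (mkseq x n) `<=` cylinder (mkseq x m).
Proof.
move=> /subnKC <-; elim: (n - m)%N => [|k IH]; first by rewrite addn0.
by rewrite addnS mkseqS cylinder_rcons => y [/IH].
Qed.

Lemma cylinder_meet u s x : (size u <= size s)%N ->
  cylinder u x -> cylinder s x -> cylinder s `<=` cylinder u.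
Proof.
by move=> us <- <-; apply: le_cylinder_mkseq; rewrite ?size_mkseq.
Qed.

Lemma clopen_coord (n : nat) (b : bool) :
  clopen ([set x | x n = b] : set cantor_space).
Proof.
apply: (@preimage_clopen cantor_space bool (fun x => x n) [set b]).
  by split; [exact: discrete_open|exact: discrete_closed].
exact: (@proj_continuous nat (fun=> bool) n).
Qed.

Lemma clopen_cylinder s : clopen (cylinder s).
Proof.
elim/last_ind: s => [|s b IH]; first by rewrite cylinder_nil; exact: clopenT.
by rewrite cylinder_rcons; apply: clopenI => //; exact: clopen_coord.
Qed.

Lemma open_cylinder (U : set cantor_space) x : open U -> U x ->
  exists n, cylinder (mkseq x n) `<=` U.
Proof.
move=> oU Ux.
have : compact (~` U).
  apply: (subclosed_compact _ cantor_space_compact) => //.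
  exact: open_closedC.
rewrite compact_cover => /(_ nat setT (fun n => ~` cylinder (mkseq x n))).
case.
- by move=> i _; apply: closed_openC; exact: (clopen_cylinder _).2.
- move=> y Uy; have [n xyn] : exists n, x n != y n.
    apply: contrapT => xy; apply: Uy; suff -> : y = x by [].
    by apply/funext => n; apply/eqP; apply: contrapT => /negP ne;
      apply: xy; exists n; rewrite eq_sym.
  exists n.+1 => //; rewrite mkseqS cylinder_rcons /= size_mkseq => -[_ /eqP].
  by rewrite eq_sym (negPf xyn).
- move=> D _ UD; exists (\max_(i <- enum_fset D) i)%N => y xy.
  apply: contrapT => /UD[i /= iD]; apply.
  by apply: le_cylinder_mkseq xy; exact: (@leq_bigmax_seq _ _ xpredT id).
Qed.

Definition borel_cantor := g_sigma_algebraType (@open cantor_space).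

HB.instance Definition _ := Measurable.on borel_cantor.

Section haar.
Context {R : realType}.
Local Open Scope ereal_scope.

(* The Caratheodory outer measure of the premeasure [s] |-> 2^-|s|. On Borel
   sets it is the product measure: see haar_cylinder and the probability
   instance. *)
Definition haar (A : set cantor_space) : \bar R :=
  ereal_inf [set \sum_(k <oo) (2 ^- size (F k))%:E |
    F in [set F : nat -> seq bool | A `<=` \bigcup_k cylinder (F k)]].

Let w (s : seq bool) : R := (2 ^- size s)%R.

Let w_ge0 s : (0 <= w s)%R.
Proof. by rewrite invr_ge0 exprn_ge0. Qed.

Let w_ge0E s : 0 <= (w s)%:E.
Proof. by rewrite lee_fin. Qed.

Let w_rcons s b : (w (rcons s b) = w s / 2)%R.
Proof. by rewrite /w size_rcons exprSr invfM mulrC. Qed.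

Let haar_ge0 A : 0 <= haar A.
Proof. by apply: le_ereal_inf_tmp => x [F AF <-{x}]; exact: nneseries_ge0. Qed.

Let le_haar : {homo haar : A B / A `<=` B >-> A <= B}.
Proof.
move=> A B AB; apply/ereal_inf_le_tmp => x [F BF <-{x}].
by exists F => //; exact: subset_trans AB BF.
Qed.

Let small (e : {posnum R}) : exists s, (w s <= e%:num)%R.
Proof.
have [N _ /(_ N (leqnn N))] := near_infty_natSinv_expn_lt e.
by rewrite div1r => /ltW; exists (nseq N true); rewrite /w size_nseq.
Qed.

Let small_seq (e : {posnum R}) :
  exists F : nat -> seq bool, \sum_(k <oo) (w (F k))%:E <= e%:num%:E.
Proof.
have e0 k : (0 < e%:num / (2 ^ k.+1)%:R :> R)%R.
  by rewrite divr_gt0// ltr0n expn_gt0.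
have /choice[F wF] : forall k, exists s, (w s <= e%:num / (2 ^ k.+1)%:R)%R.
  by move=> k; exact: small (PosNum (e0 k)).
exists F; apply: le_trans (epsilon_trick0 xpredT (ltW [gt0 of e%:num])).
by apply: lee_nneseries => // k _; rewrite lee_fin.
Qed.

Let haar0 : haar set0 = 0.
Proof.
apply/eqP; rewrite eq_le haar_ge0 andbT; apply/lee_addgt0Pr => e e0.
have [F wF] := small_seq (PosNum e0); rewrite add0e.
by apply: le_trans wF; apply: ereal_inf_lbound; exists F.
Qed.

Let haar_cylinder_le s : haar (cylinder s) <= (w s)%:E.
Proof.
apply/lee_addgt0Pr => e e0; have [F wF] := small_seq (PosNum e0).
apply: le_trans (leeD2l _ wF).
pose G k := if k is k'.+1 then F k' else s.
apply: ereal_inf_lbound; exists G; first by move=> x sx; exists 0%N.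
rewrite [LHS]nneseries_recl; [|by move=> k _; exact: w_ge0E|by []].
congr (_ + _); rewrite -nneseries_addn; last by move=> k; exact: w_ge0E.
by apply: eq_eseriesr => k _; rewrite addn1.
Qed.

Let haar_sigma_subadditive : sigma_subadditive haar.
Proof.
move=> A; have [[i ioo]|] := pselect (exists i, haar (A i) = +oo).
  rewrite (eseries_pinfty _ _ ioo) ?leey// => n _.
  by rewrite -ltNye (lt_le_trans _ (haar_ge0 _)).
rewrite -forallNE => Aoo; apply/lee_addgt0Pr => e e0.
apply: le_trans (epsilon_trick xpredT _ (ltW e0)); last first.
  by move=> n; exact: haar_ge0.
pose P n (B : nat -> seq bool) := A n `<=` \bigcup_k cylinder (B k) /\
  \sum_(k <oo) (w (B k))%:E <= haar (A n) + (e / (2 ^ n.+1)%:R)%:E.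
have [G PG] : {G : nat -> nat -> seq bool & forall n, P n (G n)}.
  apply: (@choice _ _ P) => n.
  have en1 : (0 < e / (2 ^ n.+1)%:R)%R by rewrite divr_gt0// ltr0n expn_gt0.
  have fin : haar (A n) \is a fin_num.
    by rewrite ge0_fin_numE// ltey; apply/eqP; exact: Aoo.
  have [x [B AB <-] xS] := lb_ereal_inf_adherent en1 fin.
  by exists B; split => //; exact: ltW.
have /card_esym/ppcard_eqP[f] := card_nat2.
apply: (@le_trans _ _ (\esum_(i in setT) ((w (G i.1 i.2))%:E))).
  apply: ereal_inf_lbound; exists (fun k => G (f k).1 (f k).2).
    move=> t [n _ /((PG n).1)[k _ tk]]; exists (f^-1%FUN (n, k)) => //=.
    by rewrite invK ?inE.
  rewrite -(esum_pred_image (fun i => (w (G i.1 i.2))%:E) f xpredT) ?[fun=> _]set_true//.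
  by rewrite image_eq.
have -> : [set: nat * nat] = [set: nat] `*`` (fun=> [set: nat]).
  by apply/seteqP; split.
rewrite -(@esum_esum _ _ _ setT (fun=> setT) (fun i j => (w (G i j))%:E))//.
rewrite nneseries_esumT; last by move=> n; apply: adde_ge0 => //; rewrite lee_fin divr_ge0// ltW.
apply: le_esum => n _; rewrite -nneseries_esumT; last first.
  by move=> k; exact: w_ge0E.
exact: (PG n).2.
Qed.

HB.instance Definition _ := isOuterMeasure.Build R cantor_space haar
  haar0 haar_ge0 le_haar haar_sigma_subadditive.

Let short_in (L : seq (seq bool)) s u : (size u <= size s)%N -> u \in L ->
  (w s <= \sum_(v <- L) w v)%R.
Proof.
move=> us uL; rewrite (big_rem u)//= -[leLHS]addr0 lerD ?sumr_ge0//.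
by rewrite /w lef_pV2 ?posrE ?exprn_gt0// ler_weXn2l ?ler1n.
Qed.

Let fin_cover n (L : seq (seq bool)) s :
  (forall u, u \in L -> (size u <= size s + n)%N) ->
  cylinder s `<=` [set x | exists2 u, u \in L & cylinder u x] ->
  (w s <= \sum_(u <- L) w u)%R.
Proof.
elim: n L s => [|n IH] L s Ln sL.
all: have [[u uL [us usize]]|nu] := pselect (exists2 u, u \in L &
  cylinder u (nth false s) /\ (size u <= size s)%N); first exact: short_in uL.
  have [u uL ux] := sL _ (cylinder_nth s).
  by case: nu; exists u => //; split=> //; rewrite -[size s]addn0 Ln.
pose L' b := [seq u <- L | nth false u (size s) == b].
have Lb b : (w (rcons s b) <= \sum_(u <- L' b) w u)%R.
  apply: IH => [u|x].
    by rewrite mem_filter size_rcons addSnnS => /andP[_]; exact: Ln.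
  rewrite cylinder_rcons => -[sx xb]; have [u uL ux] := sL _ sx.
  exists u => //; rewrite mem_filter uL andbT.
  have us : (size s < size u)%N.
    rewrite ltnNge; apply/negP => us; apply: nu; exists u => //.
    by split=> //; apply: (cylinder_meet us ux sx); exact: cylinder_nth.
  by rewrite -{1}ux nth_mkseq//; exact/eqP.
have -> : w s = (w (rcons s true) + w (rcons s false))%R.
  by rewrite !w_rcons -splitr.
apply: le_trans (lerD (Lb true) (Lb false)) _.
rewrite !big_filter [leRHS](bigID (fun u => nth false u (size s)))/=.
by under eq_bigl do rewrite eqb_id; rewrite lerD2l;
   under eq_bigl do rewrite eqbF_neg.
Qed.

Lemma haar_cylinder s : haar (cylinder s) = (2 ^- size s)%:E.
Proof.
apply/eqP; rewrite eq_le haar_cylinder_le/=.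
apply: le_ereal_inf_tmp => _ [F sF <-].
have : compact (cylinder s).
  apply: (subclosed_compact _ cantor_space_compact) => //.
  exact: (clopen_cylinder s).2.
rewrite compact_cover => /(_ nat setT (fun k => cylinder (F k))).
case=> [i _||D _ sD]; [exact: (clopen_cylinder _).1|exact: sF|].
pose L := [seq F i | i <- enum_fset D].
have : (w s <= \sum_(u <- L) w u)%R.
  apply: (@fin_cover (\max_(u <- L) size u)%N).
    by move=> u uL; rewrite (leq_trans (@leq_bigmax_seq _ _ xpredT size _ uL isT))// leq_addl.
  by move=> x /sD[i /= iD ix]; exists (F i) => //; exact: map_f.
rewrite big_map -lee_fin => /le_trans; apply.
rewrite -sumEFin nneseries_esumT; last by move=> k; exact: w_ge0E.
apply: esum_ge; exists [set` D]; first by split.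
by rewrite fsbig_finite//= set_fsetK.
Qed.

Let haar_coord n u : haar (cylinder u `&` [set x | x n = true]) +
  haar (cylinder u `&` ~` [set x | x n = true]) <= (w u)%:E.
Proof.
have [m] := ubnP (n.+1 - size u); elim: m u => // m IH u.
have [un|nu _] := leqP (size u) n; last first.
  have uE b : nth false u n = b -> cylinder u `<=` [set x | x n = b].
    by move=> <- x /= ux; rewrite -{1}ux nth_mkseq.
  case E : (nth false u n); move/uE: E => E.
    rewrite [X in _ + haar X](_ : _ = set0) ?haar0 ?adde0; last first.
      by rewrite -subset0 => x [/E].
    by apply: le_trans (haar_cylinder_le u); apply: le_haar => x [].
  rewrite [X in haar X + _](_ : _ = set0) ?haar0 ?add0e; last first.
    by rewrite -subset0 => x [/E/= ->].
  by apply: le_trans (haar_cylinder_le u); apply: le_haar => x [].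
rewrite ltnS => nm.
have -> : w u = (w (rcons u true) + w (rcons u false))%R.
  by rewrite !w_rcons -splitr.
have IHb b := IH (rcons u b); rewrite EFinD.
apply: le_trans (leeD (IHb true _) (IHb false _)); last 2 first.
- by rewrite size_rcons subSS; move: nm; rewrite subSn.
- by rewrite size_rcons subSS; move: nm; rewrite subSn.
rewrite {1 2}cylinder_split !setIUl addeACA.
by apply: leeD; exact: outer_measureU2.
Qed.

Let caratheodory_coord n :
  haar.-caratheodory ([set x | x n = true] : set cantor_space).
Proof.
apply: le_caratheodory_measurable => X; apply: le_ereal_inf_tmp => _ [F XF <-].
set E := [set x | x n = true].
apply: (@le_trans _ _ (\sum_(k <oo) haar (cylinder (F k) `&` E) +
                       \sum_(k <oo) haar (cylinder (F k) `&` ~` E))).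
  apply: leeD; (apply: le_trans (haar_sigma_subadditive _); apply: le_haar).
    by rewrite -setI_bigcupl; exact: setSI.
  by rewrite -setI_bigcupl; exact: setSI.
rewrite -nneseriesD//; apply: lee_nneseries => [k _|k _].
  by rewrite adde_ge0.
exact: haar_coord.
Qed.

Let caratheodory_cylinder s : haar.-caratheodory (cylinder s).
Proof.
elim/last_ind: s => [|s b IH].
  rewrite cylinder_nil -setC0; apply: caratheodory_measurable_setC.
  exact: caratheodory_measurable_set0.
rewrite cylinder_rcons; apply: caratheodory_measurable_setI => //.
case: b; first exact: caratheodory_coord.
rewrite (_ : [set _ | _] = ~` [set x | x (size s) = true]).
  by apply: caratheodory_measurable_setC; exact: caratheodory_coord.
by apply/seteqP; split=> x /=; case: (x (size s)).
Qed.

Let caratheodory_open (U : set cantor_space) : open U -> haar.-caratheodory U.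
Proof.
move=> oU; pose A (k : nat) : set cantor_space := [set x | exists s : seq bool,
  [/\ choice.unpickle k = Some s, cylinder s `<=` U & cylinder s x]].
have -> : U = \bigcup_k A k.
  apply/seteqP; split=> [x Ux|x [k _ [s [_ sU /sU]]]//].
  have [n xU] := open_cylinder oU Ux; exists (choice.pickle (mkseq x n)) => //.
  by exists (mkseq x n); rewrite choice.pickleK; split=> //; exact: cylinder_mkseq.
apply: caratheodory_measurable_bigcup => k.
have [[s [ks sU]]|nk] := pselect (exists s : seq bool,
    choice.unpickle k = Some s /\ cylinder s `<=` U).
  rewrite (_ : A k = cylinder s); first exact: caratheodory_cylinder.
  apply/seteqP; split=> x; last by move=> sx; exists s.
  by move=> [t []]; rewrite ks => -[->].
rewrite (_ : A k = set0); first exact: caratheodory_measurable_set0.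
by rewrite -subset0 => x [s [ks sU _]]; apply: nk; exists s.
Qed.

Let borel_caratheodory :
  <<s @open cantor_space >> `<=` haar.-cara.-measurable.
Proof.
apply: smallest_sub; last by move=> U; exact: caratheodory_open.
split=> //; [by move=> X mX; rewrite setTD; exact: measurableC|].
by move=> u_ mu_; exact: bigcupT_measurable.
Qed.

Let haarb : set borel_cantor -> \bar R := haar.

Let haar_semi_sigma_additive : semi_sigma_additive haarb.
Proof.
move=> F mF tF mUF; apply: caratheodory_measure_sigma_additive => //.
  by move=> i; exact: borel_caratheodory (mF i).
exact: borel_caratheodory mUF.
Qed.

HB.instance Definition _ := isMeasure.Build _ borel_cantor R
  (haar : set borel_cantor -> \bar R)
  haar0 haar_ge0 haar_semi_sigma_additive.

Let haarT : haar setT = 1.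
Proof. by rewrite -cylinder_nil haar_cylinder invr1. Qed.

HB.instance Definition _ := Measure_isProbability.Build _ borel_cantor R
  (haar : set borel_cantor -> \bar R) haarT.

End haar.

Arguments haar : clear implicits.

Definition cond_haar (R : realType) (U C : set cantor_space) : R :=
  fine (haar R (C `&` U)) / fine (haar R U).

(* A sequence suffices for countably many closed null sets: set0 is one. *)
Definition in_E (R : realType) (A : set cantor_space) : Prop :=
  exists F : nat -> set cantor_space,
    (forall n, closed (F n) /\ haar R (F n) = 0%E) /\ A `<=` \bigcup_n F n.

(* xi n is Adam's move in turn n >= 1; xi 0 is the empty sequence xi_0. *)
Definition adam_play (xi : nat -> seq bool) : Prop :=
  xi 0%N = [::] /\
  forall n, size (xi n.+1) = n.+1 /\ prefix (xi n) (xi n.+1).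

(* The union of the xi n of an adam_play. *)
Definition play_limit (xi : nat -> seq bool) : cantor_space :=
  fun n => nth false (xi n.+1) n.

Definition eve_legal (R : realType) (n : nat) (s : seq bool)
    (C : set cantor_space) : Prop :=
  [/\ clopen C, C `<=` cylinder s & cond_haar R (cylinder s) C < n%:R^-1].

Definition eve_wins (A : set cantor_space) (xi : nat -> seq bool)
    (C : nat -> set cantor_space) : Prop :=
  ~ A (play_limit xi) \/ \forall n \near \oo, C n (play_limit xi).

(* Eve's reply as a function of the list of all moves Adam has made so far;
   her own earlier moves are determined by those and the strategy. *)
Definition eve_strategy := seq (seq bool) -> set cantor_space.

Definition eve_reply (sigma : eve_strategy) (xi : nat -> seq bool) (n : nat) :
  set cantor_space := sigma [seq xi i | i <- iota 1 n].

Definition eve_winning (R : realType) (A : set cantor_space)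
    (sigma : eve_strategy) : Prop :=
  forall xi, adam_play xi ->
    (forall n, (0 < n)%N -> eve_legal R n (xi n) (eve_reply sigma xi n)) /\
    eve_wins A xi (eve_reply sigma xi).

(* Main.v *)
Require Import Defs.
From mathcomp Require Import all_boot all_order all_algebra finmap.
From mathcomp Require Import all_classical all_reals all_analysis.

(** The last position contains all of Adam's earlier ones, so a strategy of Eve
is no more than a choice, for each finite sequence [s], of a clopen subset of
[cylinder s] of small relative measure.

If [B] is covered by closed null sets [F k], Eve answers [s] of length [n] with
a clopen set that contains the part of [F 0, ..., F (n - 1)] inside
[cylinder s]. This finite union is compact and null, so the set can be taken
as small as she needs ([haar_clopen_cover]); a limit lying in [F k] is then
caught at every turn after the [k]-th.

Conversely, fix a winning strategy and let [D n] be the set of the [x] that lie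
in Eve's [n]-th reply when Adam plays the initial segments of [x]. On each
cylinder of length [n] the set [D n] coincides with a single legal reply, so it
is closed and has measure at most [1 / n]. Hence, for each [m], the
intersection of the [D n] with [n > m] is a closed null set, and winning says
that these intersections cover [B]. *)

Set Implicit Arguments.
Unset Strict Implicit.
Unset Printing Implicit Defensive.

Import Order.TTheory GRing.Theory Num.Theory.

Local Open Scope classical_set_scope.
Local Open Scope ring_scope.

(** The binary tree of height [n], read from its leaves to its root. It carries
over to the whole space any property of cylinders that passes from the two
halves of a cylinder to the cylinder itself. *)
Lemma seq_split_ind (P : seq bool -> Prop) n :
  (forall s, size s = n -> P s) ->
  (forall s, P (rcons s true) -> P (rcons s false) -> P s) -> P [::].
Proof.
move=> Pn Psplit; suff: forall k s, (size s + k)%N = n -> P s by apply.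
elim=> [|k IH] s; first by rewrite addn0; exact: Pn.
by move=> sk; apply: Psplit; apply: IH; rewrite size_rcons addSnnS.
Qed.

Lemma closed_cylinderwise (A : set cantor_space) n :
  (forall s, size s = n -> closed (A `&` cylinder s)) -> closed A.
Proof.
move=> An; rewrite -[A]setIT -cylinder_nil.
apply: (@seq_split_ind (fun s => closed (A `&` cylinder s)) n An) => s ? ?.
by rewrite cylinder_split setIUr; exact: closedU.
Qed.

Lemma haar_le_cylinderwise (R : realType) (A : set cantor_space) n (c : R) :
  (forall s, size s = n ->
    (haar R (A `&` cylinder s) <= (c * 2 ^- size s)%:E)%E) ->
  (haar R A <= c%:E)%E.
Proof.
move=> An.
suff: (haar R (A `&` cylinder [::]) <= (c * 2 ^- size (@nil bool))%:E)%E.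
  by rewrite cylinder_nil setIT expr0 invr1 mulr1.
apply: (@seq_split_ind (fun s =>
  (haar R (A `&` cylinder s) <= (c * 2 ^- size s)%:E)%E) n An) => s st sf.
rewrite cylinder_split setIUr.
have -> : c * 2 ^- size s =
    c * 2 ^- size (rcons s true) + c * 2 ^- size (rcons s false).
  by rewrite !size_rcons exprS invfM -mulrDr ![2^-1 * _]mulrC -splitr.
by apply: le_trans (outer_measureU2 _ _ _) _; rewrite EFinD leeD.
Qed.

(** The bound on the conditional measure becomes a bound on the measure itself,
which can be added over the cylinders of a given length. *)
Lemma eve_legal_haar (R : realType) n s (C : set cantor_space) :
  eve_legal R n s C -> (haar R C <= (n%:R^-1 * 2 ^- size s)%:E)%E.
Proof.
move=> [_ Cs]; rewrite /cond_haar (setIidl Cs) haar_cylinder /=.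
rewrite ltr_pdivrMr ?invr_gt0 ?exprn_gt0// => /ltW.
rewrite -lee_fin fineK// ge0_fin_numE; last exact: outer_measure_ge0.
apply: le_lt_trans (le_outer_measure (haar R) _ _ Cs) _.
by rewrite /= haar_cylinder ltry.
Qed.

Lemma haar_eve_legal (R : realType) n s (C : set cantor_space) :
  clopen C -> C `<=` cylinder s ->
  (haar R C < (n%:R^-1 * 2 ^- size s)%:E)%E -> eve_legal R n s C.
Proof.
move=> oC Cs hC; split=> //.
rewrite /cond_haar (setIidl Cs) haar_cylinder /=.
rewrite ltr_pdivrMr ?invr_gt0 ?exprn_gt0// -lte_fin fineK//.
rewrite ge0_fin_numE; last exact: outer_measure_ge0.
by apply: lt_trans hC _; rewrite ltry.
Qed.

(** Outer regularity, with clopen sets because closed sets are compact: a nearly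
optimal cover by cylinders has a finite subcover, whose union is clopen. *)
Lemma haar_clopen_cover (R : realType) (F : set cantor_space) e :
  closed F -> (haar R F < e)%E ->
  exists C, [/\ clopen C, F `<=` C & (haar R C < e)%E].
Proof.
move=> cF /ereal_inf_lt[_ [u Fu <-] ue].
have : compact F by apply: (subclosed_compact cF cantor_space_compact).
rewrite compact_cover => /(_ nat setT (fun k => cylinder (u k))).
case=> [i _||D _ FD]; [exact: (clopen_cylinder _).1|exact: Fu|].
exists (\bigcup_(k in [set` D]) cylinder (u k)); split=> //.
  split; first by apply: bigcup_open => i _; exact: (clopen_cylinder _).1.
  by apply: closed_bigcup => // i _; exact: (clopen_cylinder _).2.
apply: le_lt_trans ue; under eq_eseriesr do rewrite -haar_cylinder.
apply: le_trans (outer_measure_sigma_subadditive (haar R) _).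
by apply: le_outer_measure => x [k _ xk]; exists k.
Qed.

Lemma closed_null_bigsetU (R : realType) (F : nat -> set cantor_space) n :
  (forall k, closed (F k) /\ haar R (F k) = 0%E) ->
  closed (\big[setU/set0]_(k < n) F k) /\
  haar R (\big[setU/set0]_(k < n) F k) = 0%E.
Proof.
move=> F0; split; first by apply: closed_bigsetU => k _; exact: (F0 k).1.
apply/eqP; rewrite eq_le outer_measure_ge0 andbT.
apply: le_trans (outer_measure_subadditive (haar R) F n) _.
by rewrite big1// => k _; exact: (F0 k).2.
Qed.

Lemma play_limit_cylinder xi n : adam_play xi -> cylinder (xi n) (play_limit xi).
Proof.
move=> [xi0 xiS]; elim: n => [|n IH]; first by rewrite xi0.
have [szS /prefixP[t xiE]] := xiS n.
have sz : size (xi n) = n by case: n {IH szS xiE} => [|n]; [rewrite xi0|have [] := xiS n].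
case: t xiE => [|b [|c t]] xiE; move: szS; rewrite xiE size_cat sz /= ?addn0 ?addn1.
- by move/n_Sn.
- move=> _; rewrite cats1 cylinder_rcons; split=> //=.
  by rewrite sz /play_limit xiE nth_cat sz ltnn subnn.
- by move/eqP; rewrite -[n.+1]addn1 eqn_add2l.
Qed.

Lemma adam_play_mkseq (x : cantor_space) : adam_play (mkseq x).
Proof.
by split=> // n; rewrite size_mkseq mkseqS -cats1 prefix_prefix.
Qed.

Lemma play_limit_mkseq (x : cantor_space) : play_limit (mkseq x) = x.
Proof. by apply/funext => n; rewrite /play_limit nth_mkseq. Qed.

(** The reply in turn [n] depends on the first [n] bits alone, which makes it
constant along each cylinder of length [n]. *)
Lemma eve_reply_mkseq sigma (x y : cantor_space) n :
  mkseq x n = mkseq y n ->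
  eve_reply sigma (mkseq x) n = eve_reply sigma (mkseq y) n.
Proof.
move=> xy; congr sigma; apply/eq_in_map => i.
rewrite mem_iota add1n ltnS => /andP[_ ilen].
apply/eq_in_map => j; rewrite mem_iota add0n => /andP[_ ji].
have jn := leq_trans ji ilen.
by rewrite -(nth_mkseq false x jn) xy nth_mkseq.
Qed.

Lemma in_E_eve_winning (R : realType) (B : set cantor_space) :
  in_E R B -> exists sigma : eve_strategy, eve_winning R B sigma.
Proof.
move=> [F [F0 BF]].
pose G n := \big[setU/set0]_(k < n) F k.
(* The bound n > 0 is there because 0^-1 = 0 leaves no room for a legal set. *)
have /choice[C CP] : forall p : nat * seq bool, exists C,
    (0 < p.1)%N -> eve_legal R p.1 p.2 C /\ G p.1 `&` cylinder p.2 `<=` C.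
  move=> [n s] /=; case: (posnP n) => [_|n0]; first by exists set0.
  have [cG hG] := closed_null_bigsetU n F0.
  have [|C [oC GC hC]] := @haar_clopen_cover R _
    (n%:R^-1 * 2 ^- size s)%:E cG.
    by rewrite hG lte_fin mulr_gt0// invr_gt0 ?exprn_gt0// ltr0n.
  exists (C `&` cylinder s) => _; split; last exact: setSI.
  apply: haar_eve_legal => //; first by apply: clopenI => //; exact: clopen_cylinder.
  by apply: le_lt_trans hC; apply: le_outer_measure => x [].
exists (fun h => C (size h, last [::] h)) => xi xiP.
have replyE n :
    eve_reply (fun h => C (size h, last [::] h)) xi n = C (n, xi n).
  rewrite /eve_reply size_map size_iota; congr (C (_, _)).
  case: n => [|n]; first by rewrite xiP.1.
  by rewrite -[n.+1]addn1 iotaD map_cat last_cat /= add1n addn1.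
split=> [n n0|]; first by rewrite replyE; exact: (CP (n, xi n) n0).1.
have [/BF[k _ Fk]|] := pselect (B (play_limit xi)); last by left.
right; exists k.+1 => // n /= kn; rewrite replyE.
have n0 : (0 < n)%N by apply: leq_trans kn.
apply: (CP (n, xi n) n0).2; split; last exact: play_limit_cylinder.
by rewrite /G /= -bigcup_mkord; exists k.
Qed.

Lemma eve_winning_in_E (R : realType) (B : set cantor_space) sigma :
  eve_winning R B sigma -> in_E R B.
Proof.
move=> win.
pose D n : set cantor_space := [set x | eve_reply sigma (mkseq x) n x].
have Ds n s : (0 < n)%N -> size s = n ->
    exists2 C, eve_legal R n s C & D n `&` cylinder s = C.
  move=> n0 sn; set y : cantor_space := nth false s.
  have ys : mkseq y n = s by rewrite -sn; exact: cylinder_nth.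
  have := (win _ (adam_play_mkseq y)).1 n n0; rewrite ys => legal.
  exists (eve_reply sigma (mkseq y) n) => //.
  have sE x : cylinder s x ->
      eve_reply sigma (mkseq x) n = eve_reply sigma (mkseq y) n.
    by rewrite /cylinder /= sn -{1}ys => /eve_reply_mkseq.
  have [_ Cs _] := legal; apply/seteqP; split=> [x [Dx sx]|x Cx].
    by rewrite -(sE _ sx).
  by split; [rewrite /D /= sE//; exact: Cs|exact: Cs].
have closedD n : (0 < n)%N -> closed (D n).
  move=> n0; apply: (@closed_cylinderwise _ n) => s sn.
  by have [C [[_ cC] _ _] ->] := Ds n s n0 sn.
have haarD n : (0 < n)%N -> (haar R (D n) <= (n%:R^-1)%:E)%E.
  move=> n0; apply: (@haar_le_cylinderwise _ _ n) => s sn.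
  by have [C /eve_legal_haar legal ->] := Ds n s n0 sn.
(* The indices start above m, so that turn 0, which is not played, is left out. *)
exists (fun m => \bigcap_(n in [set n | (m < n)%N]) D n); split=> [m|x Bx].
  split; first by apply: closed_bigI => n /= mn; apply: closedD; case: n mn.
  apply/eqP; rewrite eq_le outer_measure_ge0 andbT.
  apply/lee_addgt0Pr => e e0; rewrite add0e.
  have [N _ /(_ (maxn N m) (leq_maxl _ _)) Ne] :=
    near_infty_natSinv_lt (PosNum e0).
  apply: (@le_trans _ _ (haar R (D (maxn N m).+1))).
    by apply: le_outer_measure => x; apply; rewrite /= ltnS leq_maxr.
  by apply: le_trans (haarD _ _) _ => //; rewrite lee_fin ltW.
have [_] := win _ (adam_play_mkseq x); rewrite /eve_wins play_limit_mkseq.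
by case=> // -[m _ mD]; exists m => // n /= /ltnW; exact: mD.
Qed.

Theorem corollary7p4 (R : realType) (B : set cantor_space)
    (mB : measurable (B : set borel_cantor)) :
  in_E R B <-> exists sigma : eve_strategy, eve_winning R B sigma.
Proof.
split; first exact: in_E_eve_winning.
by move=> [sigma]; exact: eve_winning_in_E.
Qed.
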